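(* Let $G$ be a finite stage-game, let $v\in F^{\mathrm{NE}}$ and let $\xi>0$. There exists $\underline\delta<1$ such that for every $\delta\in(0,1)$ with $\delta>\underline\delta$ there is a threshold $T^\ast$ with the following property: for every horizon $T\ge T^\ast$ there are a deposit scheme $d=(d^i_t)_{i\in N,\,t\in[T]}$ and a terminal-payoff rule $w=(w^i)_{i\in N}$, satisfying the feasibility condition $w^i(h_T)\le\sum_{t=1}^Tp^i_td^i_t$ for every player $i\in N$ and every terminal history $h_T=(a_t,p_t)_{t=1}^T\in H_T$, such that $G^T_\delta(d,w)$ admits a subgame perfect equilibrium whose normalised on-path payoff vector lies within $\xi$ of $v$, i.e. at Euclidean distance at most $\xi$ from $v$.
   Context: **Stage-game.** $G=(N,\{A^i\}_{i\in N},\{r^i\}_{i\in N})$, where $N$ is a finite set of players, $A^i$ is a finite (nonempty) set of actions of player $i$, $A=\prod_{i\in N}A^i$, and $r^i:A\to\mathbb R$ is player $i$'s stage payoff, $r=(r^i)_{i\in N}$. $\Delta(A^i)$ is the set of mixed actions of player $i$, $\Delta=\prod_i\Delta(A^i)$, and $r^i$ is extended multilinearly to $\Delta$. $\mathcal N(G)\subseteq\Delta$ is the set of (mixed) Nash equilibria of $G$ and $r^{i,\mathrm{NE}}:=\min_{\alpha\in\mathcal N(G)}r^i(\alpha)$. Let $F:=\operatorname{co}\{r(a):a\in A\}\subset\mathbb R^N$ (convex hull) and $F^{\mathrm{NE}}:=\{v\in F: v^i>r^{i,\mathrm{NE}}\text{ for every }i\in N\}$. **The augmented game $G^T_\delta(d,w)$.**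 The horizon is $T$, $[T]=\{1,\dots,T\}$, and the deposit scheme $d=(d^i_t)_{i\in N,t\in[T]}$ consists of fixed non-negative reals. In each period $t\in[T]$: all players simultaneously choose actions $a^i_t\in A^i$; the action profile $a_t$ is observed by all and player $i$ gets $r^i(a_t)$; then the players simultaneously decide whether to pay the deposit $d^i_t$ ($p^i_t=1$) or not ($p^i_t=0$), and $p_t=(p_t^i)_{i\in N}$ is observed by all. $H_t=(A\times\{0,1\}^N)^t$ is the set of histories of length $t$ ($H_0$ contains only the empty history). A terminal-payoff rule is $w=(w^i)_{i\in N}$ with $w^i:H_T\to\mathbb R_{\ge0}$. The payoff of player $i$ at $h_T=(a_t,p_t)_{t=1}^T$ is $$U^i(h_T)=\sum_{t=1}^T\delta^{t-1}\big(r^i(a_t)-p^i_td^i_t\big)+\delta^{T-1}w^i(h_T).$$ **Strategies and equilibrium.** A strategy of player $i$ is $(\sigma^i,\rho^i)=(\sigma^i_t,\rho^i_t)_{t\in[T]}$ with $\sigma^i_t:H_{t-1}\to\Delta(A^i)$ (action rule; players randomise independently) and $\rho^i_t:H_{t-1}\times A\to\{0,1\}$ (deposit rule). $\mathbb E_{(\sigma,\rho)}$ is the expectation over terminal histories under the profile $(\sigma,\rho)$, and $\mathbb E_{(\sigma,\rho)|h}$ the expectation when the history $h$ has occurred and play then follows $(\sigma,\rho)$. A profile $(\sigma^*,\rho^* )$ is a subgame perfect equilibrium if for every $i\in N$, every strategy $(\sigma^i,\rho^i)$ of player $i$ and every $h\in\bigcup_{t=0}^{T-1}H_t$, $\mathbb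 E_{(\sigma^*,\rho^* )|h}[U^i(h_T)]\ge\mathbb E_{(({\sigma^*}^{-i},{\rho^*}^{-i}),(\sigma^i,\rho^i))|h}[U^i(h_T)]$. **Normalised payoff.** The normalised on-path payoff vector of an equilibrium $(\sigma,\rho)$ is $\Big(\frac{1-\delta}{1-\delta^T}\,\mathbb E_{(\sigma,\rho)}[U^i(h_T)]\Big)_{i\in N}$. *)

(* Defs.v *)
From HB Require Import structures.
From mathcomp Require Export all_boot all_order all_algebra.
From mathcomp Require Export classical_sets reals.

Set Implicit Arguments.
Unset Strict Implicit.
Unset Printing Implicit Defensive.

Import Order.TTheory GRing.Theory Num.Theory.
Local Open Scope classical_set_scope.
Local Open Scope ring_scope.

Record dist (R : realType) (X : finType) := Dist {
  dist_fun :> {ffun X -> R};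
  dist_ge0 : forall x, 0 <= dist_fun x;
  dist_sum1 : \sum_x dist_fun x = 1 }.

Section StageGame.
Variables (R : realType) (N : finType) (A : N -> finType).

Definition profile : finType := {dffun forall i : N, A i}.

Variable r : N -> profile -> R.

Definition mixed_profile := forall i : N, dist R (A i).

Definition mixed_payoff (i : N) (alpha : mixed_profile) : R :=
  \sum_(a : profile) (\prod_j alpha j (a j)) * r i a.

Definition nash : set mixed_profile :=
  [set alpha | forall (i : N) (beta : dist R (A i)),
     mixed_payoff i (dfwith alpha beta) <= mixed_payoff i alpha].

Definition feasible_payoffs : set (N -> R) :=
  [set v | exists lambda : dist R profile,
     forall i, v i = \sum_a lambda a * r i a].

(* The minimum is a relation, so that no junk value is attached to a set *)
(* without a minimum.                                                    *)
Definition is_min (S : set R) (m : R) : Prop := S m /\ lbound S m.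

Definition nash_min (i : N) (m : R) : Prop :=
  is_min [set mixed_payoff i alpha | alpha in nash] m.

Definition FNE : set (N -> R) :=
  [set v | feasible_payoffs v /\
     forall i, exists m, nash_min i m /\ m < v i].

End StageGame.

(* Periods are numbered from 0: [t : 'I_T] stands for period t + 1, which is *)
(* entered with a history of length t and discounted by delta ^ t.           *)
Section AugmentedGame.
Variables (R : realType) (N : finType) (A : N -> finType).
Variables (r : N -> profile A -> R) (T : nat) (delta : R).

Definition outcome : finType := (profile A * {ffun N -> bool})%type.

Definition history (t : nat) : finType := t.-tuple outcome.

Definition past (hT : history T) (t : 'I_T) : history t :=
  [tuple tnth hT (widen_ord (ltnW (ltn_ord t)) k) | k < t].

Definition acts (hT : history T) (t : 'I_T) : profile A := (tnth hT t).1.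
Definition pays (hT : history T) (t : 'I_T) : {ffun N -> bool} :=
  (tnth hT t).2.

Record strategy (i : N) := Strategy {
  action_rule : forall t : 'I_T, history t -> dist R (A i);
  deposit_rule : forall t : 'I_T, history t -> profile A -> bool }.

Definition strategy_profile := forall i : N, strategy i.

Definition period_prob (s : strategy_profile) (hT : history T) (t : 'I_T) : R :=
  let h := past hT t in
  let a := acts hT t in
  (\prod_i action_rule (s i) h (a i)) *
  [forall i, pays hT t i == deposit_rule (s i) h a]%:R.

(* Probability of the terminal history [hT] once [h] has occurred: [hT] must *)
(* extend [h], and only the periods after [h] are played according to [s].   *)
Definition hist_prob (s : strategy_profile) (h : seq outcome)
    (hT : history T) : R :=
  (prefix h hT)%:R * \prod_(t < T | (size h <= t)%N) period_prob s hT t.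

Definition expect (s : strategy_profile) (h : seq outcome)
    (f : history T -> R) : R :=
  \sum_(hT : history T) hist_prob s h hT * f hT.

Variables (d : N -> 'I_T -> R) (w : N -> history T -> R).

Definition deposit_scheme : Prop := forall i t, 0 <= d i t.

Definition terminal_rule : Prop := forall i hT, 0 <= w i hT.

Definition feasible_rule : Prop :=
  forall i hT, w i hT <= \sum_(t < T) (pays hT t i)%:R * d i t.

Definition payoff (i : N) (hT : history T) : R :=
  \sum_(t < T) delta ^+ t * (r i (acts hT t) - (pays hT t i)%:R * d i t)
  + delta ^+ T.-1 * w i hT.

(* The lengths [t : 'I_T] of the histories are exactly 0, ..., T - 1. *)
Definition subgame_perfect (s : strategy_profile) : Prop :=
  forall (i : N) (s' : strategy i) (t : 'I_T) (h : history t),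
    expect (dfwith s s') h (payoff i) <= expect s h (payoff i).

Definition normalised_payoff (s : strategy_profile) (i : N) : R :=
  (1 - delta) / (1 - delta ^+ T) * expect s [::] (payoff i).

End AugmentedGame.

Definition eucl_dist (R : realType) (N : finType) (u v : N -> R) : R :=
  Num.sqrt (\sum_i (u i - v i) ^+ 2).

(* Main.v *)
(* A sequence of pure profiles that greedily follows the weights of v has     *)
(* payoffs whose partial sums stay within a constant of those of v, so all    *)
(* its discounted tails are near v, uniformly in delta and T. It is played    *)
(* as long as nobody deviates; the first deviator j triggers the Nash         *)
(* equilibrium worst for j until the end. A single deposit D is paid in the   *)
(* first period and refunded at the end iff nobody ever deviated. With x the  *)
(* discount factor delta ^ (T - 1 - t), a deviation in period t loses, up  *)
(* to constants, (1 - x) eps delta / (1 - delta) of surplus over the Nash     *)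
(* payoff (eps being the gap) and x D of refund,                              *)
(* an average of two numbers that exceed the gain when delta is near 1: the   *)
(* surplus deters early deviations and the refund deters late ones. In the    *)
(* first period the surplus also pays for the delay (1 - x) D of the refund.  *)

From mathcomp Require Import boolp ring lra.
Require Import Defs.

Set Implicit Arguments.
Unset Strict Implicit.
Unset Printing Implicit Defensive.

Import Order.TTheory GRing.Theory Num.Theory.
Local Open Scope ring_scope.

(** Play follows a deterministic path whose payoffs average to [v]; Nash reversion deters early
    deviations, and the deposit held hostage deters those near the horizon, where no future is left
    to lose. Subgame perfection rests on one potential, [value]: the payoff already collected plus a
    prospect that depends only on the date and the first deviator. It is a martingale under [grim]
    ([value_grim]) and a supermartingale under any unilateral deviation ([value_deviation]), so
    [expect_superharmonic] handles all deviations at once. After a deviation this is the Nash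
    property; before one it is the inequality [deterred]. [greedy_discrepancy] and [abel_bound] keep
    the tails of the path near [v], whence [calibrated_deterred]. Path error and delayed refund cost
    a bounded total, which normalisation scales by a factor of order [1 - delta]
    ([calibrated_payoff]). *)

(** * Product distributions and point masses *)

Section ProfileDistributions.
Variables (R : realType) (N : finType) (A : N -> finType).
Implicit Type alpha : mixed_profile R A.

Lemma prod_dist_ge0 alpha (a : profile A) : 0 <= \prod_i alpha i (a i).
Proof. by apply: prodr_ge0 => i _; apply: dist_ge0. Qed.

Lemma sum_prod_dist alpha : \sum_(a : profile A) \prod_i alpha i (a i) = 1.
Proof.
rewrite (reindex (@dffun_of_fprod _ A)) /=; last first.
  exact/onW_bij/dffun_of_fprod_bij.
under eq_bigr do under eq_bigr do rewrite ffunE.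
rewrite (big_fprod 1 _ (fun i => dist_fun (alpha i))).
rewrite -(bigA_distr_big_dep (fun i => tagged_with A i)
  (fun i => untag 0 (alpha i))).
apply: big1 => i _; rewrite -(dist_sum1 (alpha i)).
by rewrite (big_tag (fun i => alpha i)); apply: eq_bigl.
Qed.

Definition point_mass (X : finType) (x : X) : {ffun X -> R} :=
  [ffun y => (y == x)%:R].

Lemma point_mass_ge0 (X : finType) (x y : X) : 0 <= point_mass x y.
Proof. by rewrite ffunE ler0n. Qed.

Lemma point_mass_sum1 (X : finType) (x : X) : \sum_y point_mass x y = 1.
Proof.
rewrite (bigD1 x) //= big1 ?addr0 => [|y neq_yx]; rewrite ffunE ?eqxx //.
by rewrite (negPf neq_yx).
Qed.

Definition point (X : finType) (x : X) : dist R X :=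
  Dist (point_mass_ge0 x) (point_mass_sum1 x).

Lemma pointE (X : finType) (x y : X) : point x y = (y == x)%:R.
Proof. by rewrite ffunE. Qed.

End ProfileDistributions.

(** * Expected payoffs as a Markov chain on histories *)

Section Verification.
Variables (R : realType) (N : finType) (A : N -> finType) (T : nat).
Implicit Types (s : strategy_profile R A T) (o : outcome A).

(** The transition kernel: [period_prob] with the past as an argument, so that histories can be
    extended one outcome at a time. *)
Definition step s (t : 'I_T) (h : history A t) o : R :=
  (\prod_i action_rule (s i) h (o.1 i)) *
  [forall i, o.2 i == deposit_rule (s i) h o.1]%:R.

Lemma step_ge0 s (t : 'I_T) (h : history A t) o : 0 <= step s h o.
Proof.
by rewrite mulr_ge0 ?ler0n // (prod_dist_ge0 (fun i => action_rule (s i) h)).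
Qed.

(** Deposit rules are deterministic, so each action profile carries exactly one payment vector of
    nonzero weight. *)
Lemma sum_step s (t : 'I_T) (h : history A t) (F : profile A -> R) :
  \sum_o step s h o * F o.1 =
  \sum_(a : profile A) (\prod_i action_rule (s i) h (a i)) * F a.
Proof.
rewrite -(pair_bigA _ (fun a p => step s h (a, p) * F a)) /=.
apply: eq_bigr => a _; pose p0 := [ffun i => deposit_rule (s i) h a].
rewrite /step (bigD1 p0) //= [X in _ + X]big1 => [|p neq_p].
  rewrite addr0; case: forallP => [|[]]; first by rewrite mulr1.
  by move=> i; rewrite ffunE.
case: forallP => [eq_p|]; last by rewrite mulr0 mul0r.
by case/eqP: neq_p; apply/ffunP => i; rewrite ffunE (eqP (eq_p i)).
Qed.

Lemma sum_step1 s (t : 'I_T) (h : history A t) : \sum_o step s h o = 1.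
Proof.
rewrite -(sum_prod_dist (fun i => action_rule (s i) h)).
have := sum_step s h (fun=> 1).
by under eq_bigr do rewrite mulr1; under [in RHS]eq_bigr do rewrite mulr1.
Qed.

Lemma pastE (t : 'I_T) (h : history A t) (hT : history A T) :
  prefix h hT -> past hT t = h.
Proof.
rewrite prefixE size_tuple => /eqP eq_h; apply: val_inj => /=.
rewrite -eq_h; case: t h eq_h => t ltt h _ /=.
case: (posnP t) => [t0|t_gt0].
  by subst t; rewrite take0; apply: size0nil; rewrite size_map size_enum_ord.
have x0 : outcome A := tnth hT (Ordinal ltt).
apply: (@eq_from_nth _ x0).
  by rewrite size_map size_enum_ord size_takel // size_tuple ltnW.
move=> k; rewrite size_map size_enum_ord => ltk.
rewrite (nth_map (Ordinal ltk)) ?size_enum_ord // nth_take //.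
by rewrite (tnth_nth x0) /= nth_enum_ord.
Qed.

Lemma prefix_rconsE (t : 'I_T) (h : history A t) (hT : history A T) o :
  prefix (rcons h o) hT = prefix h hT && (tnth hT t == o).
Proof.
rewrite !prefixE size_rcons !size_tuple (take_nth o) ?size_tuple //.
by rewrite eqseq_rcons (tnth_nth o).
Qed.

Lemma expect_step s (t : 'I_T) (h : history A t) (f : history A T -> R) :
  expect s h f = \sum_o step s h o * expect s (rcons h o) f.
Proof.
rewrite /expect; under [RHS]eq_bigr do rewrite mulr_sumr.
rewrite exchange_big; apply: eq_bigr => hT _ /=.
(* Only the outcome that [hT] itself shows in period [t] contributes. *)
rewrite (bigD1 (tnth hT t)) //=.
rewrite [X in _ + X]big1 ?addr0 => [|o neq_o]; last first.
  rewrite /hist_prob prefix_rconsE [tnth hT t == o]eq_sym (negPf neq_o) andbF.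
  by rewrite !mul0r mulr0.
rewrite /hist_prob prefix_rconsE eqxx andbT size_rcons size_tuple.
case: (boolP (prefix h hT)) => [pre_h|_]; last by rewrite !(mul0r, mulr0).
rewrite (bigD1 t) //= /period_prob (pastE pre_h) -/(step s h (tnth hT t)).
rewrite !mul1r -!mulrA; congr (_ * (_ * (_ * _))); apply: eq_bigl => u.
by rewrite ltn_neqAle andbC eq_sym.
Qed.

Lemma expect_end s (hT : history A T) f : expect s hT f = f hT.
Proof.
have hpE hT' : hist_prob s hT hT' = (hT' == hT)%:R.
  rewrite /hist_prob big_pred0 ?mulr1 => [|t]; last first.
    by rewrite size_tuple leqNgt ltn_ord.
  by rewrite prefixE size_tuple -{1}(size_tuple hT') take_size.
rewrite /expect (bigD1 hT) //= hpE eqxx mul1r big1 ?addr0 // => hT' neq.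
by rewrite hpE (negPf neq) mul0r.
Qed.

(** Backward induction on the number of remaining periods. It replaces the one-shot deviation
    principle. *)
Lemma expect_superharmonic s (V : seq (outcome A) -> R) :
  (forall (t : 'I_T) (h : history A t),
     \sum_o step s h o * V (rcons h o) <= V h) ->
  forall (k : nat) (h : history A k), (k <= T)%N ->
    expect s h (fun hT => V hT) <= V h.
Proof.
move=> superV k; move eqn: (T - k)%N => n.
elim: n k eqn => [|n IHn] k eqn h leT.
  have eqk : k = T by apply/eqP; rewrite eqn_leq leT -subn_eq0 eqn.
  by subst k; rewrite expect_end.
have ltT : (k < T)%N by rewrite -subn_gt0 eqn.
rewrite (@expect_step s (Ordinal ltT) h).
apply: le_trans (superV (Ordinal ltT) h); apply: ler_sum => o _.
apply: ler_wpM2l; first exact: step_ge0.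
by apply: (IHn k.+1 _ [tuple of rcons h o]) => //; rewrite subnS eqn.
Qed.

Lemma expect_harmonic s (V : seq (outcome A) -> R) :
  (forall (t : 'I_T) (h : history A t),
     \sum_o step s h o * V (rcons h o) = V h) ->
  forall (k : nat) (h : history A k), (k <= T)%N ->
    expect s h (fun hT => V hT) = V h.
Proof.
move=> harmV k h leT; apply/le_anti/andP; split.
  by apply: expect_superharmonic => // t h'; rewrite harmV.
rewrite -lerN2; have -> : - expect s h (fun hT => V hT) =
    expect s h (fun hT => (fun h => - V h) hT).
  by rewrite /expect -sumrN; apply: eq_bigr => hT _; rewrite mulrN.
apply: (expect_superharmonic (V := fun h => - V h)) => // t h'.
by under eq_bigr do rewrite mulrN; rewrite sumrN harmV.
Qed.

End Verification.

(** * Greedy sequences of low discrepancy *)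

Section LowDiscrepancy.
Variables (R : realType) (X : finType) (x0 : X) (lambda : dist R X).

Definition greedy (e : X -> R) : X := [arg max_(y > x0) (e y + lambda y)]%O.

(* [debt n x] is [n * lambda x] minus the number of times [x] was played     *)
(* before time [n].                                                          *)
Fixpoint debt (n : nat) (x : X) : R :=
  if n is n'.+1 then debt n' x + lambda x - (x == greedy (debt n'))%:R else 0.

Definition greedy_seq n := greedy (debt n).

Lemma sum_debt n : \sum_x debt n x = 0.
Proof.
elim: n => [|n IHn] /=; first by rewrite big1.
rewrite big_split big_split /= IHn dist_sum1 add0r sumrN.
rewrite (bigD1 (greedy (debt n))) //= eqxx big1 ?addr0 ?subrr // => x neq.
by rewrite (negPf neq).
Qed.

(** Only the played [x] loses 1, and it maximises [debt n x + lambda x]; these numbers sum to 1, so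
    their maximum is not negative. *)
Lemma debt_geN1 n x : -1 <= debt n x.
Proof.
elim: n x => [|n IHn] x /=; first by rewrite lerN10.
case: eqP => [->|_]; last first.
  by rewrite subr0 -[-1]addr0 lerD ?dist_ge0.
rewrite -[leLHS]add0r lerD2r /greedy.
case: Order.TotalTheory.arg_maxP => // y _ max_y.
rewrite leNgt; apply/negP => lt0.
have : \sum_z (debt n z + lambda z) <= 0.
  by apply: sumr_le0 => z _; apply: le_trans (max_y z isT) (ltW lt0).
by rewrite big_split /= sum_debt dist_sum1 add0r ler10.
Qed.

(** Debts sum to zero, so one debt is minus the sum of the others, each at least -1. *)
Lemma debt_le_card n x : debt n x <= #|X|%:R.
Proof.
have := sum_debt n; rewrite (bigD1 x) //= => /eqP; rewrite addr_eq0 => /eqP ->.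
rewrite -sumrN; apply: le_trans (_ : \sum_(y : X | y != x) 1 <= _).
  by apply: ler_sum => y _; rewrite lerNl debt_geN1.
by rewrite sumr_const ler_nat max_card.
Qed.

Lemma greedy_discrepancy (f : X -> R) :
  exists S : nat -> R,
    (forall n, S n.+1 - S n = f (greedy_seq n) - \sum_x lambda x * f x) /\
    (forall n, `|S n| <= #|X|%:R * \sum_x `|f x|).
Proof.
exists (fun n => - \sum_x debt n x * f x); split=> n.
  rewrite opprK -sumrN -big_split /=.
  have -> : f (greedy_seq n) = \sum_x (x == greedy_seq n)%:R * f x.
    rewrite (bigD1 (greedy_seq n)) //= eqxx mul1r big1 ?addr0 // => x neq.
    by rewrite (negPf neq) mul0r.
  rewrite -sumrB; apply: eq_bigr => x _.
  by rewrite /greedy_seq; ring.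
rewrite normrN; apply: le_trans (ler_norm_sum _ _ _) _.
rewrite mulr_sumr; apply: ler_sum => x _; rewrite normrM ler_wpM2r //.
rewrite ler_norml debt_le_card andbT; apply: le_trans (debt_geN1 n x).
by rewrite lerN2 ler1n; apply/card_gt0P; exists x0.
Qed.

End LowDiscrepancy.

(** * Discounted sums *)

Section Discounting.
Variables (R : realType) (delta : R).
Hypotheses (delta_gt0 : 0 < delta) (delta_lt1 : delta < 1).

(* Summation by parts: adding [delta ^ t * S t] turns the sum into an average *)
(* of values of [S].                                                         *)
Lemma abel_bound (S : nat -> R) (B : R) :
  (forall n, `|S n| <= B) -> forall t T : nat,
  `|\sum_(t <= k < T) delta ^+ k * (S k.+1 - S k)| <= 2 * B * delta ^+ t.
Proof.
move=> S_le t T.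
have d_ge0 k : 0 <= delta ^+ k by rewrite exprn_ge0 // ltW.
suff avg : `|\sum_(t <= k < T) delta ^+ k * (S k.+1 - S k) + delta ^+ t * S t|
    <= delta ^+ t * B.
  have := ler_normB
    (\sum_(t <= k < T) delta ^+ k * (S k.+1 - S k) + delta ^+ t * S t)
    (delta ^+ t * S t).
  rewrite addrK => /le_trans; apply.
  have -> : 2 * B * delta ^+ t = delta ^+ t * B + delta ^+ t * B by ring.
  by rewrite lerD // normrM (ger0_norm (d_ge0 t)) ler_wpM2l.
move eqn: (T - t)%N => n; elim: n t eqn => [|n IHn] t eqn.
  rewrite big_geq; last by rewrite -subn_eq0 eqn.
  by rewrite add0r normrM (ger0_norm (d_ge0 t)) ler_wpM2l.
rewrite big_ltn; last by rewrite -subn_gt0 eqn.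
have := IHn t.+1; rewrite subnS eqn => /(_ erefl) le_tail.
set tail := \sum_(_ <= _ < _) _ in le_tail *.
have -> : delta ^+ t * (S t.+1 - S t) + tail + delta ^+ t * S t =
  (1 - delta) * delta ^+ t * S t.+1 + (tail + delta ^+ t.+1 * S t.+1).
  by rewrite exprS; ring.
have -> : delta ^+ t * B = (1 - delta) * delta ^+ t * B + delta ^+ t.+1 * B.
  by rewrite exprS; ring.
apply: le_trans (ler_normD _ _) _; rewrite lerD //.
have w_ge0 : 0 <= (1 - delta) * delta ^+ t by rewrite mulr_ge0 // subr_ge0 ltW.
by rewrite normrM (ger0_norm w_ge0) ler_wpM2l.
Qed.

Lemma sum_discount (t T : nat) : (t <= T)%N ->
  \sum_(t <= k < T) delta ^+ k = (delta ^+ t - delta ^+ T) / (1 - delta).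
Proof.
have neq0 : 1 - delta != 0 by rewrite subr_eq0 eq_sym lt_eqF.
elim: T => [|T IHT].
  by rewrite leqn0 => /eqP ->; rewrite big_geq // subrr mul0r.
rewrite leq_eqVlt => /predU1P[->|leT]; first by rewrite big_geq // subrr mul0r.
by rewrite big_nat_recr //= IHT // exprS; field.
Qed.

(** Bernoulli's inequality, at an exponent where [1 + n (1 - delta)] has reached 2. *)
Lemma expr_le_half : exists n : nat, forall m, (n <= m)%N -> delta ^+ m <= 2^-1.
Proof.
have bernoulli n : delta ^+ n * (1 + n%:R * (1 - delta)) <= 1.
  elim: n => [|n IHn]; first by rewrite mul0r addr0 mulr1.
  apply: le_trans IHn; rewrite exprSr -mulrA.
  apply: ler_wpM2l; first by rewrite exprn_ge0 // ltW.
  rewrite -natr1; rewrite -subr_ge0.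
  have -> : 1 + n%:R * (1 - delta) - delta * (1 + (n%:R + 1) * (1 - delta))
    = (n%:R + 1) * (1 - delta) ^+ 2 by ring.
  by rewrite mulr_ge0 ?sqr_ge0 // addr_ge0.
pose n := Num.truncn (1 - delta)^-1; exists n.+1 => m le_nm.
have d1 : 0 < 1 - delta by rewrite subr_gt0.
have gt1 : 1 <= n.+1%:R * (1 - delta).
  by rewrite -ler_pdivrMr // mul1r ltW // truncnS_gt.
have : delta ^+ m <= delta ^+ n.+1 by rewrite ler_wiXn2l // ltW.
move/le_trans; apply.
have := bernoulli n.+1; have := exprn_ge0 n.+1 (ltW delta_gt0).
have : (2^-1 : R) * 2 = 1 by rewrite mulVf // pnatr_eq0.
nra.
Qed.

End Discounting.

(** * The grim-trigger profile and its value function *)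

Section GrimTrigger.
Variables (R : realType) (N : finType) (A : N -> finType).
Variables (r : N -> profile A -> R) (a : nat -> profile A).
Variables (alpha : N -> mixed_profile R A) (delta D : R) (T : nat).
Implicit Types (h : seq (outcome A)) (o : outcome A).

(* Not paying a zero deposit also counts as a deviation. If several players   *)
(* deviate at once any of them may be blamed, as no unilateral deviation      *)
(* leads there.                                                              *)
Definition deviator (t : nat) o : option N :=
  [pick j | (o.1 j != a t j) || ~~ o.2 j].

Fixpoint culprit_from (t : nat) h : option N :=
  if h is o :: h' then
    if deviator t o is Some j then Some j else culprit_from t.+1 h'
  else None.

Definition culprit := culprit_from 0.

Definition dep (i : N) (t : 'I_T) : R := (t == 0 :> nat)%:R * D.

Definition refund (i : N) (hT : history A T) : R := (~~ culprit hT)%:R * D.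

Definition grim : strategy_profile R A T := fun i =>
  @Strategy R N A T i
    (fun t (h : history A t) =>
       if culprit h is Some j then alpha j i else point R (a t i))
    (fun _ _ _ => true).

Lemma culprit_rcons h o :
  culprit (rcons h o) =
  if culprit h is Some j then Some j else deviator (size h) o.
Proof.
rewrite /culprit -[size h]add0n; elim: h 0%N => [|o' h IHh] t /=.
  by rewrite addn0; case: (deviator t o).
by case: (deviator t o') => //; rewrite IHh addSnnS.
Qed.

Lemma deviatorN t o : deviator t o = None -> o.1 = a t /\ forall j, o.2 j.
Proof.
rewrite /deviator; case: pickP => // nodev _; split.
  by apply/ffunP => j; apply/eqP; have := nodev j; case: eqP.
by move=> j; have /negbT := nodev j; rewrite negb_or !negbK => /andP[].
Qed.

Lemma deviator_eq t o i j :
  (forall k, k != i -> o.1 k = a t k /\ o.2 k) ->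
  deviator t o = Some j -> j = i.
Proof.
rewrite /deviator => obey; case: pickP => // k dev_k [<-]; apply/eqP.
by apply: contraTT dev_k => /obey[-> ->]; rewrite eqxx.
Qed.

(** A refund requires that nobody deviated, hence that everybody paid [D] in the first period. *)
Lemma feasible_refund : 0 <= D -> (0 < T)%N -> feasible_rule dep refund.
Proof.
move=> D_ge0 T_gt0 i hT; rewrite /refund.
have term_ge0 (t : 'I_T) : 0 <= (pays hT t i)%:R * dep i t.
  by rewrite !mulr_ge0 ?ler0n.
case eqc: (culprit hT) => [j|]; first by rewrite mul0r sumr_ge0.
rewrite (bigD1 (Ordinal T_gt0)) //= /dep mul1r.
suff -> : pays hT (Ordinal T_gt0) i by rewrite !mul1r lerDl sumr_ge0.
rewrite /pays (tnth_nth (a 0, [ffun => true])) /=.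
case: (hT : seq _) (size_tuple hT) eqc => [|o h] /=.
  by move=> eqT; rewrite -eqT in T_gt0.
rewrite /culprit /=; case dev: (deviator 0 o) => //= _ _.
by have [_ ->] := deviatorN dev.
Qed.

Definition gain (i : N) h : R :=
  \sum_(k < size h) delta ^+ k *
     (r i (nth (a 0, [ffun => true]) h k).1
      - ((nth (a 0, [ffun => true]) h k).2 i)%:R * ((k == 0 :> nat)%:R * D)).

(** Discounting is from the start of the game. The punishment branch has no deposit because a
    culprit can exist only once the first period is over. *)
Definition prospect (i : N) (t : nat) (c : option N) : R :=
  if c is Some j then \sum_(t <= k < T) delta ^+ k * mixed_payoff r i (alpha j)
  else \sum_(t <= k < T) delta ^+ k * r i (a k)
       - (t == 0)%:R * D + delta ^+ T.-1 * D.

(* What player [i] expects in total after [h] when everybody plays [grim].    *)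
Definition value (i : N) h : R := gain i h + prospect i (size h) (culprit h).

Lemma gain_rcons i h o :
  gain i (rcons h o) =
  gain i h + delta ^+ size h *
    (r i o.1 - (o.2 i)%:R * ((size h == 0)%:R * D)).
Proof.
rewrite /gain size_rcons big_ord_recr /= nth_rcons ltnn eqxx; congr (_ + _).
by apply: eq_bigr => k _; rewrite nth_rcons ltn_ord.
Qed.

Lemma value_rcons i h o :
  value i (rcons h o) =
  gain i h + delta ^+ size h *
    (r i o.1 - (o.2 i)%:R * ((size h == 0)%:R * D)) +
  prospect i (size h).+1
    (if culprit h is Some j then Some j else deviator (size h) o).
Proof. by rewrite /value gain_rcons culprit_rcons size_rcons. Qed.

Lemma value_end i (hT : history A T) : (0 < T)%N ->
  value i hT = payoff r delta dep refund i hT.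
Proof.
move=> T_gt0; rewrite /value /payoff /gain /refund size_tuple.
congr (_ + _).
  apply: eq_bigr => t _.
  by rewrite /acts /pays !(tnth_nth (a 0, [ffun => true])).
case: culprit => [j|] /=; rewrite big_geq //; first by rewrite mul0r mulr0.
by rewrite eqn0Ngt T_gt0 mul0r subr0 add0r mul1r.
Qed.

Lemma sum_step_punished s i (t : 'I_T) (h : history A t) j :
  culprit h = Some j ->
  \sum_o step s h o * value i (rcons h o) =
  gain i h + delta ^+ t * mixed_payoff r i (fun k => action_rule (s k) h)
  + \sum_(t.+1 <= k < T) delta ^+ k * mixed_payoff r i (alpha j).
Proof.
move=> eqc; have size_h : size h != 0.
  by apply/negP => /nilP eqh; move: eqc; rewrite eqh.
under eq_bigr do
  rewrite value_rcons eqc (negPf size_h) mul0r mulr0 subr0 size_tuple.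
rewrite /prospect; set tail := \sum_(_ <= _ < _) _.
rewrite /mixed_payoff -sum_step mulr_sumr -[X in _ = X + _ + _]mul1r
  -[X in _ = _ + X]mul1r.
rewrite -(sum_step1 s h) !mulr_suml -!big_split /=.
by apply: eq_bigr => o _; ring.
Qed.

(** Only player [k] is assumed to follow [grim], so this serves both for equilibrium play and for
    unilateral deviations. *)
Lemma step_obey s (t : 'I_T) (h : history A t) o k :
  culprit h = None -> s k = grim k -> step s h o != 0 ->
  o.1 k = a t k /\ o.2 k.
Proof.
move=> eqc sE; rewrite /step mulf_eq0 negb_or => /andP[act_neq0].
case: forallP => [/(_ k)|_]; last by rewrite eqxx.
rewrite sE => /eqP -> _; split=> //.
move: act_neq0; rewrite (bigD1 k) //= mulf_eq0 negb_or => /andP[+ _].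
by rewrite sE /= eqc pointE; case: (o.1 k =P a t k) => //; rewrite eqxx.
Qed.

Lemma value_conform i (t : 'I_T) (h : history A t) o :
  culprit h = None -> deviator t o = None -> value i (rcons h o) = value i h.
Proof.
move=> eqc nodev; have [o1E paid] := deviatorN nodev.
rewrite value_rcons /value eqc size_tuple nodev o1E paid mul1r /=.
(* The deposit is discounted in [gain] but not in [prospect]; both agree as it falls due in period
   0. *)
have undiscounted : delta ^+ t * (t == 0 :> nat)%:R = (t == 0 :> nat)%:R.
  by case: (posnP t) => [->|t_gt0]; rewrite ?mul1r ?mulr0.
rewrite [in RHS]big_ltn // -[in RHS]undiscounted mul0r subr0; ring.
Qed.

Lemma step_neq0_sum s (t : 'I_T) (h : history A t) (F : outcome A -> R) c :
  (forall o, step s h o != 0 -> F o <= c) -> \sum_o step s h o * F o <= c.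
Proof.
move=> F_le; rewrite -[c]mul1r -(sum_step1 s h) mulr_suml.
apply: ler_sum => o _; have [->|neq0] := eqVneq (step s h o) 0.
  by rewrite !mul0r.
by rewrite ler_wpM2l ?step_ge0 // F_le.
Qed.

Lemma value_grim i (t : 'I_T) (h : history A t) :
  \sum_o step grim h o * value i (rcons h o) = value i h.
Proof.
case eqc: (culprit h) => [j|].
  rewrite (sum_step_punished _ _ eqc) /value eqc size_tuple /=.
  rewrite [in RHS]big_ltn // addrA; congr (_ + _ * _ + _).
  by apply: eq_bigr => b _; congr (_ * _); apply: eq_bigr => k _; rewrite eqc.
rewrite -[RHS]mul1r -(sum_step1 grim h) mulr_suml; apply: eq_bigr => o _.
have [->|neq0] := eqVneq (step grim h o) 0; first by rewrite !mul0r.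
rewrite value_conform // /deviator; case: pickP => // k.
by have [-> ->] := step_obey eqc (erefl (grim k)) neq0; rewrite eqxx.
Qed.

Hypotheses (delta_ge0 : 0 <= delta) (D_ge0 : 0 <= D) (T_gt0 : (0 < T)%N).
Hypothesis alpha_nash : forall j, nash r (alpha j).
(** On the left the deviator pays no deposit, gets no refund and is punished from the next period
    on. *)
Hypothesis deterred : forall i (t : 'I_T) (b : profile A),
  delta ^+ t * r i b
  + \sum_(t.+1 <= k < T) delta ^+ k * mixed_payoff r i (alpha i)
  <= prospect i t None.

Lemma value_deviation i (s' : strategy R A T i) (t : 'I_T) (h : history A t) :
  \sum_o step (dfwith grim s') h o * value i (rcons h o) <= value i h.
Proof.
case eqc: (culprit h) => [j|].
  rewrite (sum_step_punished _ _ eqc) /value eqc size_tuple /=.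
  rewrite [X in _ <= _ + X]big_ltn // -addrA lerD2l lerD2r.
  apply: ler_wpM2l; first exact: exprn_ge0.
  (* The deviation at [h] is one from the stage equilibrium [alpha j]; the continuation is
     unaffected. *)
  apply: le_trans (alpha_nash j (action_rule s' h)).
  rewrite le_eqVlt; apply/orP; left; apply/eqP.
  apply: eq_bigr => b _; congr (_ * _); apply: eq_bigr => k _.
  case: (dfwithP grim s' k) => [|k' neq_ik]; first by rewrite dfwith_in.
  by rewrite dfwith_out //= eqc.
apply: step_neq0_sum => o neq0.
case dev: (deviator t o) => [j|]; last by rewrite value_conform.
have eq_ji : j = i.
  apply: deviator_eq dev => k neq_ki; apply: (step_obey eqc) neq0.
  by rewrite dfwith_out // eq_sym.
rewrite value_rcons /value eqc size_tuple dev eq_ji -addrA lerD2l.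
apply: le_trans (deterred i t o.1); rewrite lerD2r.
(* Ignoring a deposit that the deviator may have paid only raises the bound. *)
rewrite ler_wpM2l ?exprn_ge0 // gerBl.
by rewrite !mulr_ge0 ?ler0n.
Qed.

Lemma expect_value s i (t : nat) (h : history A t) :
  expect s h (payoff r delta dep refund i) =
  expect s h (fun hT => value i hT).
Proof. by apply: eq_bigr => hT _; rewrite value_end. Qed.

Lemma grim_subgame_perfect : subgame_perfect r delta dep refund grim.
Proof.
move=> i s' t h; rewrite !expect_value.
rewrite [leRHS](expect_harmonic (V := value i)) ?(ltnW (ltn_ord t)) //; last first.
  exact: value_grim.
apply: expect_superharmonic; last exact: ltnW (ltn_ord t).
exact: value_deviation.
Qed.

Lemma grim_payoff i :
  expect grim [::] (payoff r delta dep refund i) = prospect i 0 None.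
Proof.
rewrite (expect_value grim i [tuple]).
rewrite (expect_harmonic (V := value i)) //; last exact: value_grim.
by rewrite /value /gain big_ord0 add0r.
Qed.

End GrimTrigger.

(** * Choice of constants *)

Section Calibration.
Variables (R : realType) (N : finType) (A : N -> finType).
Variables (r : N -> profile A -> R) (a : nat -> profile A) (v : N -> R).
Variables (alpha : N -> mixed_profile R A) (delta eps K B D : R) (T : nat).
Hypotheses (delta_gt0 : 0 < delta) (delta_lt1 : delta < 1) (T_gt0 : (0 < T)%N).
Hypothesis r_le : forall i b, `|r i b| <= K.
Hypothesis near_v : forall i t,
  `|\sum_(t <= k < T) delta ^+ k * (r i (a k) - v i)| <= 2 * B * delta ^+ t.
Hypothesis gap : forall i, mixed_payoff r i (alpha i) + eps <= v i.
Hypotheses (B_ge0 : 0 <= B) (K_ge0 : 0 <= K) (D_ge : 2 * K + 2 * B <= D).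
Hypothesis patient : 3 * D * (1 - delta) <= eps * delta.
Hypothesis long : delta ^+ T.-1 <= 2^-1.

Lemma path_sum i t :
  \sum_(t <= k < T) delta ^+ k * r i (a k) =
  v i * \sum_(t <= k < T) delta ^+ k
  + \sum_(t <= k < T) delta ^+ k * (r i (a k) - v i).
Proof.
rewrite mulr_sumr -big_split /=; apply: eq_bigr => k _; ring.
Qed.

(** Put [X = delta ^+ t] and [W = delta ^+ T.-1]. The stage gain and the path error cost at most
    [(2K + 2B) X <= D X], while the lost surplus is at least [3D (X - W)] by [patient] and the lost
    refund is [D W]. *)
Lemma calibrated_deterred i (t : 'I_T) (b : profile A) :
  delta ^+ t * r i b
  + \sum_(t.+1 <= k < T) delta ^+ k * mixed_payoff r i (alpha i)
  <= prospect r a alpha delta D T i t None.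
Proof.
rewrite /= -mulr_suml big_ltn // path_sum.
have := near_v i t.+1; set err := \sum_(_ <= _ < _) _ * (_ - _).
rewrite ler_norml => /andP[err_ge _].
have d1 : 0 < 1 - delta by rewrite subr_gt0.
have tailE := sum_discount delta_lt1 (ltn_ord t).
have tail_ge0 : 0 <= \sum_(t.+1 <= k < T) delta ^+ k.
  by apply: sumr_ge0 => k _; rewrite exprn_ge0 // ltW.
have lastE : delta ^+ T = delta * delta ^+ T.-1 by rewrite -exprS prednK.
have lossE : eps * \sum_(t.+1 <= k < T) delta ^+ k
    = eps * delta / (1 - delta) * (delta ^+ t - delta ^+ T.-1).
  by rewrite tailE lastE exprS; field; rewrite gt_eqF.
have q_ge : 3 * D <= eps * delta / (1 - delta) by rewrite ler_pdivlMr.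
move: lossE q_ge; set q := eps * delta / (1 - delta).
set tail := \sum_(_ <= _ < _) _ in tailE tail_ge0 *.
move=> lossE q_ge.
have loss : mixed_payoff r i (alpha i) * tail + eps * tail <= v i * tail.
  by rewrite -mulrDl ler_wpM2r // gap.
move: (r_le i b) (r_le i (a t)); rewrite !ler_norml => /andP[_ rb] /andP[ra _].
have X_gt0 : 0 < delta ^+ t by rewrite exprn_gt0.
have XW : delta ^+ T.-1 <= delta ^+ t.
  by rewrite ler_wiXn2l ?ltW // -ltnS prednK.
have W_ge0 : 0 <= delta ^+ T.-1 by rewrite exprn_ge0 // ltW.
have YX : delta ^+ t.+1 <= delta ^+ t by rewrite ler_wiXn2l ?ltW.
have XM : delta ^+ t * (r i b - r i (a t)) <= delta ^+ t * (2 * K).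
  by rewrite ler_pM2l //; lra.
have BY : 2 * B * delta ^+ t.+1 <= 2 * B * delta ^+ t.
  by rewrite ler_wpM2l // mulr_ge0.
have DX : delta ^+ t * (2 * K + 2 * B) <= delta ^+ t * D by rewrite ler_pM2l.
have qXW : 3 * D * (delta ^+ t - delta ^+ T.-1) <=
    q * (delta ^+ t - delta ^+ T.-1) by rewrite ler_wpM2r // subr_ge0.
suff : (t == 0 :> nat)%:R * D + delta ^+ t * D <=
    3 * D * (delta ^+ t - delta ^+ T.-1) + delta ^+ T.-1 * D by lra.
have D_ge0 : 0 <= D by apply: le_trans D_ge; rewrite addr_ge0 ?mulr_ge0.
(* In period 0 the deposit adds a second [D], so [W <= 1/2] is needed; later [W <= X] suffices. *)
have [->|t_gt0] := posnP t.
  have := ler_wpM2l D_ge0 long; rewrite expr0 mul1r; lra.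
have XW_ge0 : 0 <= delta ^+ t - delta ^+ T.-1 by rewrite subr_ge0.
have := mulr_ge0 D_ge0 XW_ge0.
rewrite mul0r; lra.
Qed.

(** The unnormalised error is the path error minus the delay cost [(1 - W) D], where
    [W = delta ^+ T.-1], at most [2D] in size; [1 - delta ^+ T >= 1/2] gives the other factor 2. *)
Lemma calibrated_payoff i :
  `|(1 - delta) / (1 - delta ^+ T) * prospect r a alpha delta D T i 0 None
    - v i| <= 4 * D * (1 - delta).
Proof.
rewrite /= mul1r path_sum sum_discount // expr0.
have := near_v i 0; set err := \sum_(_ <= _ < _) _.
rewrite expr0 mulr1 => err_le.
have d1 : 0 < 1 - delta by rewrite subr_gt0.
have Z_le : delta ^+ T <= 2^-1.
  by apply: le_trans long; rewrite ler_wiXn2l ?ltW // leq_pred.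
have Z1 : 2^-1 <= 1 - delta ^+ T by lra.
have Z0 : 0 < 1 - delta ^+ T by lra.
have W_ge0 : 0 <= delta ^+ T.-1 by rewrite exprn_ge0 // ltW.
have D_ge0 : 0 <= D by apply: le_trans D_ge; rewrite addr_ge0 ?mulr_ge0.
have -> : (1 - delta) / (1 - delta ^+ T) *
    (v i * ((1 - delta ^+ T) / (1 - delta)) + err - D + delta ^+ T.-1 * D) - v i
  = (1 - delta) / (1 - delta ^+ T) * (err - (1 - delta ^+ T.-1) * D).
  by field; rewrite !gt_eqF.
rewrite normrM [X in X * _]ger0_norm; last by rewrite divr_ge0 // ltW.
rewrite mulrAC ler_pdivrMr //.
have abs_le : `|err - (1 - delta ^+ T.-1) * D| <= 2 * D.
  apply: le_trans (ler_normB _ _) _.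
  have W_le1 : 0 <= 1 - delta ^+ T.-1 by have := long; lra.
  rewrite [X in _ + X]ger0_norm; last by rewrite mulr_ge0.
  have := mulr_ge0 W_ge0 D_ge0; move: D_ge K_ge0; lra.
have -> : 4 * D * (1 - delta) * (1 - delta ^+ T) =
  (1 - delta) * (4 * D * (1 - delta ^+ T)) by ring.
rewrite ler_pM2l //; apply: le_trans abs_le _.
have := ler_wpM2l D_ge0 Z1; lra.
Qed.

End Calibration.

(** * Distance, punishments and assembly *)

Lemma eucl_dist_le (R : realType) (N : finType) (u v : N -> R) (eta : R) :
  0 <= eta -> (forall i, `|u i - v i| <= eta) ->
  eucl_dist u v <= #|N|.+1%:R * eta.
Proof.
move=> eta_ge0 uv_le; rewrite /eucl_dist.
have c_ge0 : 0 <= #|N|.+1%:R * eta by rewrite mulr_ge0.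
rewrite -(ger0_norm c_ge0) -sqrtr_sqr ler_wsqrtr // exprMn.
apply: le_trans (_ : \sum_(i : N) eta ^+ 2 <= _).
  apply: ler_sum => i _.
  by rewrite -[leLHS]real_normK ?num_real // lerXn2r ?nnegrE.
rewrite sumr_const -[eta ^+ 2 *+ _]mulr_natl ler_wpM2r ?sqr_ge0 // -natrX ler_nat.
by rewrite -mulnn (leq_trans (leqnSn _)) // leq_pmulr.
Qed.

Lemma FNE_punishments (R : realType) (N : finType) (A : N -> finType)
    (r : N -> profile A -> R) (v : N -> R) : FNE r v ->
  exists (alpha : N -> mixed_profile R A) (eps : R),
    [/\ forall j, nash r (alpha j), 0 < eps &
        forall i, mixed_payoff r i (alpha i) + eps <= v i].
Proof.
case=> _ below; have pun i : exists alpha : mixed_profile R A,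
    nash r alpha /\ mixed_payoff r i alpha < v i.
  by have [m [[[alpha nash_alpha <-] _] lt_v]] := below i; exists alpha.
have [alpha alphaP] := choice pun; exists alpha.
(* The default 1 keeps the gap positive even without players. *)
exists (\big[Num.min/1]_i (v i - mixed_payoff r i (alpha i))).
split=> [j||i]; first by case: (alphaP j).
  apply: lt_bigmin => // i _; rewrite subr_gt0.
  by case: (alphaP i).
by rewrite addrC -lerBrDr; apply: bigmin_le_cond.
Qed.

Theorem corollary4 (R : realType) (N : finType) (A : N -> finType)
  (hA : forall i : N, (0 < #|A i|)%N)
  (r : N -> profile A -> R) (v : N -> R) (hv : FNE r v)
  (xi : R) (hxi : 0 < xi) :
  exists delta0 : R, delta0 < 1 /\
    forall delta : R, 0 < delta -> delta < 1 -> delta0 < delta ->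
      exists Tstar : nat, forall T : nat, (Tstar <= T)%N ->
        exists (d : N -> 'I_T -> R) (w : N -> history A T -> R),
          [/\ deposit_scheme d, terminal_rule w, feasible_rule d w &
            exists s : strategy_profile R A T,
              subgame_perfect r delta d w s /\
              eucl_dist (normalised_payoff r delta d w s) v <= xi].
Proof.
have [alpha [eps [alpha_nash eps_gt0 gap]]] := FNE_punishments hv.
have [[lambda vE] _] := hv.
have x0 : profile A := finfun (fun i => enum_val (Ordinal (hA i))).
pose a := greedy_seq x0 lambda.
pose K : R := \sum_i \sum_b `|r i b|.
pose B : R := #|profile A|%:R * K.
(* The summand 1 makes [D] positive, as the divisions by [D] below require. *)
pose D : R := 1 + 2 * K + 2 * B.
have K_ge0 : 0 <= K by apply: sumr_ge0 => i _; apply: sumr_ge0.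
have B_ge0 : 0 <= B by rewrite mulr_ge0.
have D_gt0 : 0 < D by rewrite /D; lra.
have norm1_le i : \sum_b `|r i b| <= K.
  by rewrite /K (bigD1 i) //= lerDl; apply: sumr_ge0 => ? _; apply: sumr_ge0.
have r_le i b : `|r i b| <= K.
  by apply: le_trans (norm1_le i); rewrite (bigD1 b) //= lerDl sumr_ge0.
pose eta := xi / #|N|.+1%:R.
have eta_gt0 : 0 < eta by rewrite divr_gt0.
(* The first two bounds give [patient]: [3D (1 - delta) < eps / 2 < eps * delta]. The third brings
   each coordinate within [eta]. *)
exists (1 - Num.min 2^-1 (Num.min (eps / (6 * D)) (eta / (4 * D)))).
split; first by rewrite gtrDl oppr_lt0 !lt_min invr_gt0 ltr0n !divr_gt0 ?mulr_gt0.
move=> delta delta_gt0 delta_lt1; rewrite ltrBlDr -ltrBlDl !lt_min.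
case/and3P => half; rewrite !ltr_pdivlMr ?mulr_gt0 // => eps_large eta_large.
have [n longP] := expr_le_half delta_gt0 delta_lt1.
exists n.+1 => T le_nT; have T_gt0 : (0 < T)%N by apply: leq_trans le_nT.
have long : delta ^+ T.-1 <= 2^-1 by apply: longP; rewrite -ltnS prednK.
have near_v i t :
    `|\sum_(t <= k < T) delta ^+ k * (r i (a k) - v i)| <= 2 * B * delta ^+ t.
  have [S [SE S_le]] := greedy_discrepancy x0 lambda (r i).
  under eq_bigr do rewrite vE -SE.
  apply: abel_bound => // k; apply: le_trans (S_le k) _.
  by rewrite ler_wpM2l.
have D_ge : 2 * K + 2 * B <= D by rewrite /D; lra.
have patient : 3 * D * (1 - delta) <= eps * delta.
  have := mulr_gt0 eps_gt0 (ltac:(lra) : 0 < delta - 2^-1); lra.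
exists (dep D (T := T)), (refund a D (T := T)); split.
- by move=> i t; rewrite mulr_ge0 // ltW.
- by move=> i hT; rewrite mulr_ge0 // ltW.
- by apply: feasible_refund => //; apply: ltW.
exists (grim a alpha T); split.
  apply: grim_subgame_perfect => // [||i t b]; [exact: ltW | exact: ltW |].
  exact: (calibrated_deterred delta_gt0 delta_lt1 T_gt0 r_le near_v gap).
have -> : xi = #|N|.+1%:R * eta by rewrite mulrC divfK ?pnatr_eq0.
apply: eucl_dist_le => [|i]; first exact: ltW.
rewrite /normalised_payoff grim_payoff //.
apply: le_trans (calibrated_payoff alpha delta_gt0 delta_lt1 near_v
  B_ge0 K_ge0 D_ge long i) _.
rewrite /eta ler_pdivlMr //; lra.
Qed.
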